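(* Let $B\ge1$ and let $W_1,\ldots,W_B$ be real-valued random variables which, conditionally on a random variable (or vector) $Z$ with values in a measurable space $\mathcal Z$, are independent (not necessarily identically distributed). Let $\psi:\mathcal Z\to\mathbb R$ be measurable, $F_i(z)=\mathbb P(W_i\le\psi(Z)\mid Z=z)$ for $1\le i\le B$, and $\overline F(z)=\frac1B\sum_{i=1}^BF_i(z)$. Then for any integers $a,b$ with $0\le a<B-b\le B$, $$\mathbb P\big(\psi(Z)\in[W_{(a)},W_{(B-b)}]\big)\ge 1-\frac{3(a+b+1)}{2B}-6\,d_{\mathrm{KS}}(\overline F(Z),U(0,1)).$$
   Context: All random variables are defined on a common probability space. Conditional probabilities given $Z$ are computed from a regular conditional distribution of $(W_1,\ldots,W_B)$ given $Z$, which for every $z\in\mathcal Z$ is the product of the conditional laws of the $W_i$ given $Z=z$. $W_{(1)}\le\cdots\le W_{(B)}$ are the order statistics of $W_1,\ldots,W_B$. Convention: $W_{(0)}=-\infty$, i.e. when $a=0$ the lower endpoint constraint is vacuous. For real random variables, $d_{\mathrm{KS}}(Y_1,Y_2)=\sup_{t\in\mathbb R}|\mathbb P(Y_1\le t)-\mathbb P(Y_2\le t)|$; $U(0,1)$ denotes a standard uniform random variable. *)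

(* Defs.v *)
From HB Require Import structures.
From mathcomp Require Import all_boot all_order all_algebra.
From mathcomp Require Import all_classical all_reals all_analysis.

Set Implicit Arguments.
Unset Strict Implicit.
Unset Printing Implicit Defensive.

Import Order.TTheory GRing.Theory Num.Theory.
Import numFieldNormedType.Exports.

Local Open Scope classical_set_scope.
Local Open Scope ring_scope.

(* Product probability on the product sigma-algebra of B.-tuple R, stated on
   measurable rectangles, which form a generating pi-system. *)
Definition product_of_marginals (R : realType) (B : nat)
    (mu : set (B.-tuple R) -> \bar R) : Prop :=
  forall C : 'I_B -> set R, (forall i, measurable (C i)) ->
    (mu [set w | forall i, C i (tnth w i)] =
     \prod_(i < B) mu [set w | C i (tnth w i)])%E.

Definition regular_cond_distribution (R : realType) (d d' : measure_display)
    (Omega : measurableType d) (T : measurableType d')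
    (P : probability Omega R) (B : nat) (W : 'I_B -> {RV P >-> R})
    (Z : {RV P >-> T}) (kappa : R.-pker T ~> (B.-tuple R)) : Prop :=
  forall (A : set T) (D : set (B.-tuple R)), measurable A -> measurable D ->
    (P [set om | A (Z om) /\ D [tuple W i om | i < B]] =
     \int[distribution P Z]_(z in A) kappa z D)%E.

(* P(W_i <= psi(Z) | Z = z) when kappa is a regular conditional distribution of
   (W_1, ..., W_B) given Z. *)
Definition cond_cdf (R : realType) (d' : measure_display)
    (T : measurableType d') (B : nat) (kappa : R.-pker T ~> (B.-tuple R))
    (psi : T -> R) (i : 'I_B) (z : T) : R :=
  fine (kappa z [set w | tnth w i <= psi z]).

Definition mean_cond_cdf (R : realType) (d' : measure_display)
    (T : measurableType d') (B : nat) (kappa : R.-pker T ~> (B.-tuple R))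
    (psi : T -> R) (z : T) : R :=
  B%:R^-1 * \sum_(i < B) cond_cdf kappa psi i z.

(* Order statistics are numbered from 1; the 0-th one is -oo. *)
Definition order_stat (R : realType) (B : nat) (w : B.-tuple R) (k : nat) :
    \bar R :=
  if k is k'.+1 then (nth 0 (sort <=%R w) k')%:E else -oo%E.

(* Only the laws of Y1 and Y2 matter, so they may live on different spaces. *)
Definition d_KS (R : realType) (d1 d2 : measure_display)
    (Omega1 : measurableType d1) (Omega2 : measurableType d2)
    (P1 : probability Omega1 R) (Y1 : Omega1 -> R)
    (P2 : probability Omega2 R) (Y2 : Omega2 -> R) : R :=
  sup [set `|fine (P1 [set om | Y1 om <= t]) - fine (P2 [set om | Y2 om <= t])|
      | t in [set: R]].

(* Kolmogorov-Smirnov distance to U(0, 1), realised as the identity on R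
   endowed with the uniform probability on [0, 1]. *)
Definition d_KS_U01 (R : realType) (d : measure_display)
    (Omega : measurableType d) (P : probability Omega R) (Y : Omega -> R) : R :=
  d_KS P Y (uniform_prob (@ltr01 R)) idfun.

(* Main.v *)
(* Let [N] be the number of [W_i] below [psi Z]; given [Z], it is a sum of
   independent Bernoulli variables with mean [m = B * Fbar(Z)]. The event fails
   only if [N < a] or if at most [b] of the [W_i] exceed [psi Z], and both are
   lower tails of such sums. Chernoff's bound with tilt [s = k / m] gives
   [P(N <= k | Z) <= (m / k)^k exp(k - m)] for [m >= k], a nonincreasing function
   of [m]; extended by 1 on [m <= k], its integral over all means is at most
   [3 (k + 1) / 2]. If [Fbar(Z)] were uniform, each tail would thus have
   probability at most [3 (k + 1) / (2 B)]; in general a nonincreasing function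
   with values in [0, 1] costs one extra Kolmogorov-Smirnov distance. *)
Require Import Defs.
From HB Require Import structures.
From mathcomp Require Import all_boot all_order all_algebra.
From mathcomp Require Import all_classical all_reals all_analysis.
From mathcomp Require Import ring lra zify measurable_realfun.

Set Implicit Arguments.
Unset Strict Implicit.
Unset Printing Implicit Defensive.

Import Order.TTheory GRing.Theory Num.Theory.
Import numFieldNormedType.Exports.

Local Open Scope classical_set_scope.
Local Open Scope ring_scope.

(** * Counting in sorted sequences *)

(** Since [p] is downward closed, it holds on an initial segment of the sorted sequence, and the
    length of that segment is the count. *)
Lemma sorted_nth_count (R : realType) (p : pred R) (s : seq R) (x0 : R) (k : nat) :
  (forall x y, x <= y -> p y -> p x) -> sorted <=%R s -> (k < size s)%N ->
  p (nth x0 s k) = (k < count p s)%N.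
Proof.
move=> p_down; elim: s k => [|x s IH] k //= x_s.
have s_sorted := path_sorted x_s; case: k => [_|k ks] /=.
  case: (boolP (p x)) => //= npx; apply/esym/negbTE; rewrite -leqNgt leqn0.
  rewrite -leqn0 leqNgt -has_count -all_predC.
  apply/allP => y ys /=; apply: contra npx; apply: p_down.
  exact: (allP (order_path_min le_trans x_s)).
rewrite IH //; case: (boolP (p x)) => //= npx; rewrite add0n.
suff -> : count p s = 0%N by [].
apply/eqP; rewrite -leqn0 leqNgt -has_count -all_predC.
apply/allP => y ys /=; apply: contra npx; apply: p_down.
exact: (allP (order_path_min le_trans x_s)).
Qed.

(** * The Chernoff bound as a function of the mean, and its integral *)

(* [scaled_exp_sum k x = k! \sum_(j <= k) x^j / j!], so that
   [- exp (- x) * scaled_exp_sum k x] is a primitive of [x^k exp (- x)]. *)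
Fixpoint scaled_exp_sum (R : realType) (k : nat) (x : R) : R :=
  if k is k'.+1 then x ^+ k + k%:R * scaled_exp_sum k' x else 1.

Lemma scaled_exp_sum_ge0 (R : realType) (k : nat) (x : R) :
  0 <= x -> 0 <= scaled_exp_sum k x.
Proof.
by move=> x0; elim: k => //= k IH; rewrite addr_ge0 ?mulr_ge0 ?exprn_ge0.
Qed.

Lemma is_derive_scaled_exp_sum (R : realType) (k : nat) (x : R) :
  is_derive x 1 (scaled_exp_sum k) (scaled_exp_sum k x - x ^+ k).
Proof.
elim: k => [|k IH] /=.
  rewrite expr0 subrr; exact: is_derive_cst.
rewrite [X in is_derive _ _ X _](_ : _ = (fun y : R => y) ^+ k.+1 +
  k.+1%:R *: scaled_exp_sum k); last first.
  by apply/funext => y; rewrite !fctE.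
apply: is_derive_eq; rewrite /GRing.scale/=.
by rewrite mulr1 mulrBr addrCA subrr addr0 addrAC subrr add0r.
Qed.

(** Induction on [k]: the recursion produces [k.+1 * (1 + k / 2) = k.+2 * (k.+1 / 2)], and
    [k.+2 <= x] turns the factor [k.+2] into one more power of [x]. *)
Lemma scaled_exp_sum_le (R : realType) (k : nat) (x : R) :
  k.+1%:R <= x -> scaled_exp_sum k x <= x ^+ k * (1 + k%:R / 2).
Proof.
elim: k => [|k IH] kx /=; first by rewrite expr0 mul0r addr0 mulr1.
have x0 : 0 < x by apply: lt_le_trans kx.
have /IH : k.+1%:R <= x by apply: le_trans kx; rewrite ler_nat.
move=> /(ler_wpM2l (ler0n _ k.+1)) H.
rewrite mulrDr mulr1 lerD2l; apply: (le_trans H).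
rewrite mulrCA exprSr -mulrA ler_wpM2l ?exprn_ge0 ?(ltW x0)//.
have -> : k.+1%:R * (1 + k%:R / 2) = k.+2%:R * (k.+1%:R / 2) :> R.
  by rewrite -[k.+2]addn2 -[k.+1]addn1 !natrD; field.
by rewrite ler_wpM2r ?divr_ge0.
Qed.

(** One unfolding of the recursion puts the order one below the point, as the preceding bound
    requires. *)
Lemma scaled_exp_sum_diag_le (R : realType) (k : nat) :
  scaled_exp_sum k k%:R <= k%:R ^+ k * ((k%:R + 3) / 2) :> R.
Proof.
case: k => [|k] /=; first by rewrite expr0; lra.
have := @scaled_exp_sum_le R k k.+1%:R (lexx _).
move=> /(ler_wpM2l (ler0n R k.+1)) H.
apply: (le_trans (lerD (lexx _) H)).
rewrite exprS; set y := k.+1%:R ^+ k.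
have -> : k.+1%:R = k%:R + 1 :> R by rewrite -addn1 natrD.
have -> : (k%:R + 1) * y + (k%:R + 1) * (y * (1 + k%:R / 2)) =
  (k%:R + 1) * y * ((k%:R + 1 + 3) / 2) by field.
by [].
Qed.

(** The variable [x] is the mean. For [k = 0] the power is 1 despite the division by zero, so the
    bound reads [expR (- x)]. *)
Definition lower_tail_bound (R : realType) (k : nat) (x : R) : R :=
  if x <= k%:R then 1 else (x / k%:R) ^+ k * expR (k%:R - x).

(** The primitive of [lower_tail_bound k] vanishing at 0; the constants make the two branches agree
    at [x = k]. *)
Definition lower_tail_primitive (R : realType) (k : nat) (x : R) : R :=
  if x <= k%:R then x else
  k%:R + (scaled_exp_sum k k%:R - expR (k%:R - x) * scaled_exp_sum k x) / k%:R ^+ k.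

Lemma natr_exp_self_gt0 (R : realType) (k : nat) : 0 < k%:R ^+ k :> R.
Proof. by case: k => [|k]; rewrite ?expr0// exprn_gt0. Qed.

Lemma lower_tail_bound_ge0 (R : realType) (k : nat) (x : R) :
  0 <= lower_tail_bound k x.
Proof.
rewrite /lower_tail_bound; case: (leP x) => // kx.
rewrite mulr_ge0 ?expR_ge0// exprn_ge0// divr_ge0//.
by apply: le_trans (ltW kx).
Qed.

(** From [y / x = 1 + (y - x) / x <= expR ((y - x) / x)], the [k]-th power of the ratio is at most
    [expR (k * (y - x) / x)], and [k <= x]. *)
Lemma exprn_expRN_nonincreasing (R : realType) (k : nat) (x y : R) :
  k%:R <= x -> x <= y -> y ^+ k * expR (- y) <= x ^+ k * expR (- x).
Proof.
case: k => [|k] kx xy; first by rewrite !expr0 !mul1r ler_expR lerN2.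
have x0 : 0 < x by apply: lt_le_trans kx.
suff : (y / x) ^+ k.+1 <= expR (y - x).
  rewrite expr_div_n ler_pdivrMr ?exprn_gt0// expRD => H.
  rewrite [expR (- y)]expRN ler_pdivrMr ?expR_gt0//; apply: le_trans H _.
  by rewrite mulrC [expR y * _]mulrC mulrA.
have -> : y / x = 1 + (y - x) / x by rewrite mulrBl divff ?gt_eqF// addrC subrK.
apply: (@le_trans _ _ (expR ((y - x) / x) ^+ k.+1)).
  rewrite lerXn2r ?nnegrE ?expR_ge0 ?expR_ge1Dx//.
  by rewrite addr_ge0// divr_ge0 ?subr_ge0// ltW.
rewrite -expRM_natr ler_expR mulrAC ler_pdivrMr//.
by rewrite ler_wpM2l ?subr_ge0.
Qed.

Lemma lower_tail_bound_gtE (R : realType) (k : nat) (x : R) : k%:R < x ->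
  lower_tail_bound k x = expR k%:R / k%:R ^+ k * (x ^+ k * expR (- x)).
Proof.
move=> kx; rewrite /lower_tail_bound leNgt kx/= expr_div_n expRD.
by rewrite [X in X * _]mulrC mulrACA [X in X * _]mulrC.
Qed.

Lemma lower_tail_bound_le1 (R : realType) (k : nat) (x : R) :
  lower_tail_bound k x <= 1.
Proof.
have [xk|kx] := leP x k%:R; first by rewrite /lower_tail_bound xk.
rewrite lower_tail_bound_gtE//.
apply: (@le_trans _ _ (expR k%:R / k%:R ^+ k * (k%:R ^+ k * expR (- k%:R)))).
  rewrite ler_wpM2l ?divr_ge0 ?expR_ge0 ?exprn_ge0//.
  by rewrite exprn_expRN_nonincreasing// ltW.
by rewrite mulrA divfK ?gt_eqF ?natr_exp_self_gt0// -expRD subrr expR0.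
Qed.

Lemma lower_tail_bound_nonincreasing (R : realType) (k : nat) (x y : R) :
  x <= y -> lower_tail_bound k y <= lower_tail_bound k x.
Proof.
move=> xy; have [xk|kx] := leP x k%:R.
  by rewrite {2}/lower_tail_bound xk lower_tail_bound_le1.
rewrite !lower_tail_bound_gtE ?(lt_le_trans kx)//.
rewrite ler_wpM2l ?divr_ge0 ?expR_ge0 ?exprn_ge0//.
by rewrite exprn_expRN_nonincreasing// ltW.
Qed.

Lemma is_derive_expRN_scaled_exp_sum (R : realType) (k : nat) (x : R) :
  is_derive x 1 (fun y => expR (- y) * scaled_exp_sum k y)
    (- (x ^+ k * expR (- x))).
Proof.
have := is_derive_scaled_exp_sum k x => dp.
have de : is_derive x 1 (fun y : R => expR (- y)) (- expR (- x)).
  have := @is_derive1_comp R expR -%R x (expR (- x)) (-1).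
  by rewrite mulrN1; apply.
apply: (is_derive_eq (is_deriveM de dp)); rewrite /GRing.scale/=.
ring.
Qed.

(** Stands in for integration: a rectangle of height the right-end value fits under the
    nonincreasing bound. Beyond [k] the mean value theorem gives this, below [k] the slope is 1, and
    an interval across [k] is split there. *)
Lemma lower_tail_primitive_step (R : realType) (k : nat) (x y : R) : x <= y ->
  lower_tail_bound k y * (y - x) <=
  lower_tail_primitive k y - lower_tail_primitive k x.
Proof.
have above (u v : R) : k%:R <= u -> u <= v -> lower_tail_bound k v * (v - u) <=
    (expR (k%:R - u) * scaled_exp_sum k u - expR (k%:R - v) * scaled_exp_sum k v)
      / k%:R ^+ k.
  move=> ku; rewrite le_eqVlt => /predU1P[->|uv].
    by rewrite !subrr mulr0 mul0r.
  pose f (z : R) := expR (- z) * scaled_exp_sum k z.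
  have df (z : R) := is_derive_expRN_scaled_exp_sum k z.
  have [|c] := @MVT R f _ u v uv (fun z _ => df z).
    by apply: derivable_within_continuous => z _; exact: ex_derive.
  rewrite in_itv/= => /andP[uc cv] fvu.
  have fE : f v - f u = - (c ^+ k * expR (- c)) * (v - u) := fvu.
  have kv : k%:R < v by apply: le_lt_trans uv.
  have -> : (expR (k%:R - u) * scaled_exp_sum k u -
             expR (k%:R - v) * scaled_exp_sum k v) / k%:R ^+ k =
            expR k%:R / k%:R ^+ k * (c ^+ k * expR (- c) * (v - u)).
    have -> : c ^+ k * expR (- c) * (v - u) = f u - f v.
      by rewrite -[RHS]opprB fE mulNr opprK.
    by rewrite !expRD /f; ring.
  rewrite lower_tail_bound_gtE// -mulrA.
  rewrite ler_wpM2l ?divr_ge0 ?expR_ge0 ?exprn_ge0//.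
  rewrite ler_wpM2r ?subr_ge0 ?(ltW uv)//.
  by rewrite exprn_expRN_nonincreasing ?(ltW cv)// (le_trans ku (ltW uc)).
move=> xy; rewrite /lower_tail_primitive; case: (leP y k%:R) => yk.
  by rewrite (le_trans xy yk) /lower_tail_bound yk mul1r.
case: (leP x k%:R) => xk.
  have := above k%:R y (lexx _) (ltW yk); rewrite subrr expR0 mul1r.
  have : lower_tail_bound k y * (k%:R - x) <= k%:R - x.
    by rewrite ler_piMl ?subr_ge0// lower_tail_bound_le1.
  by lra.
have := above x y (ltW xk) xy; by lra.
Qed.

(** Dropping the subtracted term leaves [k + (k + 3) / 2], which is the source of the constant
    [3 / 2]. *)
Lemma lower_tail_primitive_le (R : realType) (k : nat) (x : R) :
  lower_tail_primitive k x <= 3 * k.+1%:R / 2.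
Proof.
rewrite /lower_tail_primitive -addn1 natrD.
case: (leP x k%:R) => xk; first by have : 0 <= k%:R :> R by []; lra.
have : (scaled_exp_sum k k%:R - expR (k%:R - x) * scaled_exp_sum k x)
    / k%:R ^+ k <= (k%:R + 3) / 2.
  rewrite ler_pdivrMr ?natr_exp_self_gt0// [leRHS]mulrC.
  apply: le_trans (scaled_exp_sum_diag_le _ _).
  rewrite gerBl mulr_ge0 ?expR_ge0// scaled_exp_sum_ge0//.
  by rewrite (le_trans _ (ltW xk)).
by lra.
Qed.

(** * Lower tails of sums of independent Bernoulli variables *)

(** Here [J] is the set of successes. Chernoff: for [0 <= s <= 1], each [J] with at most [k]
    elements satisfies [s ^+ k <= s ^+ #|J|]. The tilted weights sum to the product of the
    [1 - (1 - s) * q i], at most [expR (- (1 - s) * m)], which is [expR (k - m)] for [s = k / m]. *)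
Lemma poisson_binomial_lower_tail (R : realType) (B k : nat) (q : 'I_B -> R) :
  (forall i, 0 <= q i <= 1) ->
  \sum_(J : {set 'I_B} | (#|J| <= k)%N)
     \prod_(i < B) (if i \in J then q i else 1 - q i)
  <= lower_tail_bound k (\sum_(i < B) q i).
Proof.
move=> q01.
pose w (J : {set 'I_B}) := \prod_(i < B) (if i \in J then q i else 1 - q i).
have w_ge0 J : 0 <= w J.
  apply: prodr_ge0 => i _; have /andP[q0 q1] := q01 i.
  by case: ifP => // _; rewrite subr_ge0.
set m := \sum_(i < B) q i; rewrite /lower_tail_bound; case: (leP m) => [_|km].
  (* For [m <= k] the bound is 1, the total weight of all [J]. *)
  apply: (@le_trans _ _ (\sum_(J : {set 'I_B}) w J)).
    by rewrite [leRHS](bigID (fun J : {set 'I_B} => #|J| <= k)%N)/= lerDl sumr_ge0.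
  rewrite -bigA_distr.
  by rewrite big1// => i _ /=; rewrite addrC subrK.
have m0 : 0 < m by apply: le_lt_trans km.
pose s : R := k%:R / m.
have s0 : 0 <= s by rewrite divr_ge0// ltW.
have s1 : s <= 1 by rewrite ler_pdivrMr// mul1r ltW.
have -> : (m / k%:R) ^+ k = (s ^+ k)^-1 by rewrite -exprVn invf_div.
(* For [k = 0] the tilt [s] is 0, but [s ^+ k] is still 1, hence positive. *)
rewrite mulrC ler_pdivlMr; last first.
  by rewrite expr_div_n divr_gt0 ?natr_exp_self_gt0 ?exprn_gt0.
rewrite mulrC mulr_sumr.
apply: (@le_trans _ _ (\sum_(J : {set 'I_B}) s ^+ #|J| * w J)).
  rewrite [leRHS](bigID (fun J : {set 'I_B} => #|J| <= k)%N)/=.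
  rewrite -[leLHS]addr0 lerD//; last first.
    by apply: sumr_ge0 => J _; rewrite mulr_ge0 ?exprn_ge0.
  apply: ler_sum => J Jk; apply: ler_wpM2r; first exact: w_ge0.
  by rewrite ler_wiXn2l.
have -> : \sum_(J : {set 'I_B}) s ^+ #|J| * w J =
          \prod_(i < B) (s * q i + (1 - q i)).
  rewrite bigA_distr; apply: eq_bigr => J _.
  rewrite -prodr_const [X in X * _]big_mkcond -big_split/=.
  by apply: eq_bigr => i _; case: ifP => // _; rewrite mul1r.
have -> : k%:R - m = \sum_(i < B) - ((1 - s) * q i).
  rewrite sumrN -mulr_sumr -/m mulrBl mul1r /s divfK ?opprB//.
  by rewrite gt_eqF.
rewrite expR_sum; apply: ler_prod => i _; have /andP[q0 q1] := q01 i.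
apply/andP; split; first by apply: addr_ge0; [exact: mulr_ge0|rewrite subr_ge0].
by apply: le_trans (expR_ge1Dx _); lra.
Qed.

(** Measurability travels through the induction together with the bound, because subadditivity for
    two sets asks for it. *)
Lemma measure_big_setU_le d (T : measurableType d) (R : realType)
    (mu : {measure set T -> \bar R}) (I : Type) (r : seq I) (p : pred I)
    (F : I -> set T) : (forall i, p i -> measurable (F i)) ->
  (mu (\big[setU/set0]_(i <- r | p i) F i) <= \sum_(i <- r | p i) mu (F i))%E.
Proof.
move=> mF; pose K (X : set T) (x : \bar R) := measurable X /\ (mu X <= x)%E.
suff [] : K (\big[setU/set0]_(i <- r | p i) F i) (\sum_(i <- r | p i) mu (F i))%E.
  by [].
apply: (big_ind2 K) => [|X x Y y [mX Xx] [mY Yy]|i pi].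
- by split; rewrite ?measure0.
- split; first exact: measurableU.
  by apply: (le_trans (measureU2 _ _ _)) => //; exact: leeD.
- by split; [exact: mF|].
Qed.

(** The event is split by the exact set [J] of indices satisfying [c]. Each piece [E J] is a
    measurable rectangle, so its probability factors into the weight of [J]. *)
Lemma independent_count_lower_tail (R : realType) (B k : nat)
    (mu : probability (B.-tuple R) R) (c : 'I_B -> pred R) :
  product_of_marginals mu -> (forall i, measurable [set x | c i x]) ->
  (mu [set w | (\sum_(i < B) c i (tnth w i) <= k)%N] <=
   (lower_tail_bound k
      (\sum_(i < B) fine (mu [set w | c i (tnth w i)])))%:E)%E.
Proof.
move=> mu_indep mc.
have mtnth i (D : set R) : measurable D -> measurable [set w : B.-tuple R | D (tnth w i)].
  by move=> mD; rewrite -[X in measurable X]setTI; exact: measurable_tnth.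
have mcw i : measurable [set w : B.-tuple R | c i (tnth w i)].
  exact: (mtnth i [set x | c i x]).
pose q i := fine (mu [set w | c i (tnth w i)]).
have qE i : (mu [set w | c i (tnth w i)] = (q i)%:E)%E.
  by rewrite fineK// fin_num_measure//; exact: mcw.
have qCE i : (mu [set w | ~ c i (tnth w i)] = (1 - q i)%:E)%E.
  by rewrite EFinB -qE -probability_setC//; exact: mcw.
have q01 i : 0 <= q i <= 1.
  by rewrite -!lee_fin -qE measure_ge0 probability_le1//; exact: mcw.
pose D (J : {set 'I_B}) i := if i \in J then [set x | c i x] else ~` [set x | c i x].
have mD J i : measurable (D J i).
  by rewrite /D; case: ifP => _; [exact: mc|apply: measurableC; exact: mc].
pose E (J : {set 'I_B}) := [set w : B.-tuple R | forall i, D J i (tnth w i)].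
have mE J : measurable (E J).
  rewrite (_ : E J = \bigcap_(i in [set: 'I_B]) [set w | D J i (tnth w i)]).
    by apply: fin_bigcap_measurable => // i _; apply: mtnth; exact: mD.
  by apply/seteqP; split => [w h i _|w h i]; [exact: h|exact: (h i I)].
have -> : [set w | (\sum_(i < B) c i (tnth w i) <= k)%N] =
    \big[setU/set0]_(J : {set 'I_B} | (#|J| <= k)%N) E J.
  rewrite -bigcup_seq_cond; apply/seteqP; split => w /=.
    move=> wk; exists [set i | c i (tnth w i)]%SET => /=.
      rewrite mem_index_enum /= -sum1_card big_mkcond/=.
      apply: leq_trans wk; apply: leq_sum => i _; rewrite inE.
      by case: (c i _).
    by move=> i; rewrite /D inE; case: (boolP (c i _)) => //= /negP.
  case=> J /andP[_ Jk] EJ; apply: leq_trans Jk.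
  rewrite -sum1_card [leqRHS]big_mkcond/=; apply: leq_sum => i _.
  have := EJ i; rewrite /D; case: ifP => _ /=; first by move=> ->.
  by move=> /negP/negbTE ->.
apply: (le_trans (measure_big_setU_le _ _ _)) => //.
apply: le_trans (_ : (_ <= (\sum_(J : {set 'I_B} | (#|J| <= k)%N)
     \prod_(i < B) (if i \in J then q i else 1 - q i))%:E)%E) _; last first.
  by rewrite lee_fin poisson_binomial_lower_tail.
rewrite -sumEFin; apply: lee_sum => J _.
rewrite [leLHS](mu_indep (D J) (mD J)).
rewrite -prodEFin le_eqVlt; apply/orP; left; apply/eqP; apply: eq_bigr => i _.
by rewrite /D; case: ifP => _; [exact: qE|exact: qCE].
Qed.

(** * Disintegration along the conditional kernel *)

(* The joint law of [(z, w)] with [z] drawn from [Q] and [w] from [kappa z]. *)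
Definition mixture d d' (R : realType) (T : measurableType d)
    (U : measurableType d') (Q : probability T R) (kappa : R.-pker T ~> U)
    (A : set (T * U)) : \bar R :=
  (\int[Q]_z kappa z (xsection A z))%E.

Section mixture_measure.
Context d d' (R : realType) (T : measurableType d) (U : measurableType d').
Variables (Q : probability T R) (kappa : R.-pker T ~> U).

Let mixture0 : mixture Q kappa set0 = 0%E.
Proof. by apply: integral0_eq => z _; rewrite xsection0 measure0. Qed.

Let mixture_ge0 A : (0 <= mixture Q kappa A)%E.
Proof. exact: integral_ge0. Qed.

Let mixture_sigma_additive : semi_sigma_additive (mixture Q kappa).
Proof.
move=> F mF tF mUF; rewrite /mixture.
have -> : (\int[Q]_z kappa z (xsection (\bigcup_n F n) z) =
           \sum_(0 <= n <oo) \int[Q]_z kappa z (xsection (F n) z))%E.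
  rewrite -integral_nneseries//; last first.
    by move=> n; apply: measurable_fun_xsection_finite_kernel; rewrite inE.
  apply: eq_integral => z _; rewrite xsection_bigcup.
  apply: measure_semi_bigcup.
  - by move=> n; exact: measurable_xsection.
  - exact: trivIset_xsection.
  - by apply: bigcup_measurable => n _; exact: measurable_xsection.
by apply: is_cvg_nneseries => n _ _; exact: integral_ge0.
Qed.

HB.instance Definition _ := isMeasure.Build _ _ R (mixture Q kappa)
  mixture0 mixture_ge0 mixture_sigma_additive.

End mixture_measure.

(** Extends the defining identity from rectangles to events tying [W] to [psi Z]. Both sides are
    finite measures of [E] that agree on the measurable rectangles, a generating class closed under
    intersection. *)
Lemma disintegration (R : realType) (d d' : measure_display)
    (Omega : measurableType d) (T : measurableType d')
    (P : probability Omega R) (B : nat) (W : 'I_B -> {RV P >-> R})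
    (Z : {RV P >-> T}) (kappa : R.-pker T ~> (B.-tuple R))
    (E : set (T * B.-tuple R)) :
  regular_cond_distribution W Z kappa -> measurable E ->
  (P [set om | E (Z om, [tuple W i om | i < B])] =
   \int[distribution P Z]_z kappa z (xsection E z))%E.
Proof.
move=> PWZ mE.
pose V om := (Z om, [tuple W i om | i < B]).
have mV : measurable_fun setT V.
  apply: measurable_fun_pair => //; apply/measurable_fun_tnthP => i.
  by rewrite (_ : _ \o _ = W i)//; apply/funext => om /=; rewrite tnth_mktuple.
pose C : set (set (T * B.-tuple R)) := [set A `*` D | A in measurable & D in measurable].
transitivity (pushforward P V E) => //.
apply: (@measure_unique _ R _ C (fun=> setT) _ _ _ _ (pushforward P V)
  (mixture (distribution P Z) kappa)) => //.
- exact: measurable_prod_measurableType.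
- move=> _ _ [A mA [D mD <-]] [A' mA' [D' mD' <-]].
  exists (A `&` A'); first exact: measurableI.
  by exists (D `&` D'); [exact: measurableI|rewrite setXI].
- by move=> _; exists setT => //; exists setT => //; rewrite setXTT.
- exact: bigcup_const.
- move=> _ [A mA [D mD <-]].
  transitivity (P [set om | A (Z om) /\ D [tuple W i om | i < B]]) => //.
  rewrite PWZ// [LHS]integral_mkcond; apply: eq_integral => z _.
  rewrite patchE; case: ifPn => zA; first by rewrite in_xsectionX.
  by rewrite notin_xsectionX// measure0.
- move=> _; change (P (V @^-1` setT) < +oo)%E; rewrite preimage_setT.
  by apply: (le_lt_trans (probability_le1 _ _)) => //; rewrite ltry.
Qed.

(** * Nonincreasing functions and the Kolmogorov-Smirnov distance *)

(** [G] plays the primitive of [g]. A nonincreasing step function is a positive combination of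
    indicators of [Y <= t], so upper bounds on the distribution function suffice; their errors
    [delta] are weighted by the total drop of [g], at most 1. *)
Lemma expectation_nonincreasing_le d (T : measurableType d) (R : realType)
    (Q : probability T R) (Y : T -> R) (f : T -> \bar R) (g G : R -> R) (delta : R) :
  measurable_fun [set: T] Y -> (forall z, 0 <= Y z <= 1) ->
  measurable_fun [set: T] f -> (forall z, 0 <= f z <= (g (Y z))%:E)%E ->
  0 <= delta ->
  (forall t, 0 <= t <= 1 -> (Q [set z | (Y z <= t)%R] <= (t + delta)%:E)%E) ->
  (forall x, 0 <= g x <= 1) -> {homo g : x y / x <= y >-> y <= x} ->
  (forall x y, x <= y -> g y * (y - x) <= G y - G x) ->
  (\int[Q]_z f z <= (G 1 - G 0 + delta)%:E)%E.
Proof.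
move=> mY Y01 mf fg delta0 QY g01 g_dec gG.
have g_ge0 x : 0 <= g x by have /andP[] := g01 x.
(* The term [n.+1%:R^-1] is the discretisation error for [n.+1] equal cells of the unit interval. *)
suff step (n : nat) : (\int[Q]_z f z <= (G 1 - G 0 + delta + n.+1%:R^-1)%:E)%E.
  apply/lee_addgt0Pr => e e0; have [n _ ne] := near_infty_natSinv_lt (PosNum e0).
  apply: (le_trans (step n)); rewrite -EFinD lee_fin lerD2l.
  by apply/ltW/(ne n) => /=.
have [e e_ge0 eE] : exists2 e : R, 0 <= e & e = n.+1%:R^-1.
  by exists n.+1%:R^-1; rewrite ?invr_ge0.
rewrite -eE; pose t j := j%:R * e.
have t0 : t 0%N = 0 by rewrite /t mul0r.
have tn : t n.+1 = 1 by rewrite /t eE divff.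
have tS j : t j.+1 = t j + e by rewrite /t -natr1 mulrDl mul1r.
have le_t j : t j <= t j.+1 by rewrite tS lerDl.
pose c j := g (t j) - g (t j.+1).
have c0 j : 0 <= c j by rewrite subr_ge0 g_dec.
pose A j := [set z | Y z <= t j.+1].
have mA j : measurable (A j).
  by rewrite -[X in measurable X]setTI; exact: measurable_fun_le.
pose h z := (\sum_(0 <= j < n.+1) (c j)%:E * (\1_(A j) z)%:E + (g 1)%:E)%E.
(* [h] is the step function equal to [g (t j)] on [t j < Y <= t j.+1]. *)
have fh z : (f z <= h z)%E.
  have /andP[_ fz] := fg z; apply: (le_trans fz).
  rewrite /h; under eq_bigr do rewrite -EFinM.
  rewrite sumEFin -EFinD lee_fin -tn.
  have : Y z <= t n.+1 by rewrite tn; have /andP[] := Y01 z.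
  (* Induction on the number of cells: the last indicator is 1, and its coefficient replaces
     [g (t m.+1)] by [g (t m)]. This suffices if [Y z] lies above [t m]; otherwise the induction
     hypothesis applies. *)
  elim: n.+1 => [|m IH] Ym.
    by rewrite big_nil add0r g_dec// t0; have /andP[] := Y01 z.
  rewrite big_nat_recr//= indicE mem_set//= mulr1 -addrA subrK.
  have [Yt|/ltW tY] := leP (Y z) (t m); first exact: IH.
  by rewrite (le_trans (g_dec _ _ tY))// lerDr sumr_ge0// => i _; rewrite mulr_ge0.
have m1 j : measurable_fun [set: T] (fun z => (\1_(A j) z)%:E : \bar R).
  by apply/measurable_EFinP; exact: measurable_indic.
have mc j : measurable_fun [set: T] (fun z => (c j)%:E * (\1_(A j) z)%:E)%E.
  exact: measurable_funeM.
have c1 j z : (0 <= (c j)%:E * (\1_(A j) z)%:E)%E.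
  by rewrite -EFinM lee_fin mulr_ge0.
have msum : measurable_fun [set: T]
    (fun z => \sum_(0 <= j < n.+1) (c j)%:E * (\1_(A j) z)%:E)%E.
  exact: emeasurable_sum.
have int_h : (\int[Q]_z h z =
    \sum_(0 <= j < n.+1) (c j)%:E * Q (A j) + (g 1)%:E)%E.
  rewrite /h ge0_integralD//=; last 2 first.
  - by move=> z _; apply: sume_ge0.
  - by move=> z _; rewrite lee_fin.
  rewrite integral_cst// [X in (_ + _ * X)%E]probability_setT mule1.
  congr (_ + _)%E.
  rewrite ge0_integral_sum//; apply: eq_bigr => j _.
  by rewrite ge0_integralZl_EFin// integral_indic// setIT.
apply: (@le_trans _ _ (\int[Q]_z h z)%E).
  apply: ge0_le_integral => //.
  - by move=> z _; have /andP[] := fg z.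
  - exact: emeasurable_funD.
rewrite int_h.
(* Abel summation turns the bounds on [Q (A j)] into a Riemann sum of [g]. *)
have sum_le m : \sum_(0 <= j < m) c j * (t j.+1 + delta) + g (t m) * t m
    + delta * (g (t m) - g 0) + g (t m) * e
    <= G (t m) - G 0 + g 0 * e.
  (* Summation by parts yields rectangles with left-end heights, while [gG] bounds those with
     right-end heights; the terms [g (t m) * e] and [g 0 * e] account for this shift. *)
  elim: m => [|m IH].
    by rewrite big_nil t0 mulr0 !subrr mulr0 !add0r.
  rewrite big_nat_recr//=.
  have := gG _ _ (le_t m); move: IH; rewrite /c.
  set gS := g (t m.+1); rewrite tS [t m + _ - t m]addrAC subrr add0r.
  by set S := \sum_(_ <= _ < _) _; lra.
have QA j : (j < n.+1)%N -> (Q (A j) <= (t j.+1 + delta)%:E)%E.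
  move=> jn; apply: QY; rewrite mulr_ge0//= -tn ler_wpM2r//.
  by rewrite ler_nat.
apply: (@le_trans _ _
  (\sum_(0 <= j < n.+1) c j * (t j.+1 + delta) + g 1)%:E).
  rewrite EFinD leeD2r// -sumEFin big_nat_cond [leRHS]big_nat_cond.
  apply: lee_sum => j; rewrite andbT => /andP[_ jn].
  by rewrite EFinM lee_wpmul2l// ?lee_fin// QA.
rewrite lee_fin; have := sum_le n.+1; rewrite tn.
(* What remains is [(g 0 - g 1) * (delta + e)], at most [delta + e]. *)
have ? := g_ge0 1; have : 0 <= delta * g 1 by exact: mulr_ge0.
have : 0 <= g 1 * e by exact: mulr_ge0.
have /andP[? g01'] := g01 0; have : delta * g 0 <= delta by rewrite ler_piMr.
have : g 0 * e <= e by rewrite ler_piMl.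
by move=> *; lra.
Qed.

Lemma uniform01_cdf (R : realType) (t : R) : 0 <= t <= 1 ->
  uniform_prob (@ltr01 R) [set x | idfun x <= t] = t%:E.
Proof.
move=> /andP[t0 t1]; rewrite /uniform_prob integral_uniform_pdf.
have -> : [set x : R | idfun x <= t] `&` `[0, 1] = `[0, t]%classic.
  apply/seteqP; split => x /=; rewrite !in_itv/=; first by case=> -> /andP[->].
  by move=> /andP[-> xt]; rewrite xt (le_trans xt).
rewrite (eq_integral (cst 1%:E)) ?integral_cst//=; last first.
  move=> x; rewrite inE/= in_itv/= /uniform_pdf => /andP[x0 xt].
  by rewrite x0 (le_trans xt)//= subr0 invr1.
rewrite mul1e lebesgue_measure_itv/= lte_fin.
by case: ltgtP t0 => // [_|<-]; rewrite ?sube0.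
Qed.

(** The real [sup] dominates its elements only when the set is bounded above; here 1 is a bound, as
    both distribution functions lie between 0 and 1. *)
Lemma cdf_dist_le_d_KS (R : realType) d1 d2 (Omega1 : measurableType d1)
    (Omega2 : measurableType d2) (P1 : probability Omega1 R) (Y1 : Omega1 -> R)
    (P2 : probability Omega2 R) (Y2 : Omega2 -> R) (t : R) :
  measurable_fun [set: Omega1] Y1 -> measurable_fun [set: Omega2] Y2 ->
  `|fine (P1 [set om | Y1 om <= t]) - fine (P2 [set om | Y2 om <= t])|
  <= d_KS P1 Y1 P2 Y2.
Proof.
move=> mY1 mY2.
have cdf01 d (X : measurableType d) (P : probability X R) (Y : X -> R) u :
    measurable_fun [set: X] Y -> 0 <= fine (P [set x | Y x <= u]) <= 1.
  move=> mY; have mYu : measurable [set x | Y x <= u].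
    by rewrite -[X in measurable X]setTI; exact: measurable_fun_le.
  apply/andP; split; first exact: fine_ge0.
  by rewrite -lee_fin fineK ?probability_le1// fin_num_measure.
apply: ub_le_sup; last by exists t.
exists 1 => _ [u _ <-].
have /andP[? ?] := cdf01 _ _ P1 _ u mY1; have /andP[? ?] := cdf01 _ _ P2 _ u mY2.
by rewrite ler_norml; apply/andP; split; lra.
Qed.

Lemma cdf_dist_le_d_KS_U01 (R : realType) d (Omega : measurableType d)
    (P : probability Omega R) (Y : Omega -> R) (t : R) :
  measurable_fun [set: Omega] Y -> 0 <= t <= 1 ->
  `|fine (P [set om | Y om <= t]) - t| <= d_KS_U01 P Y.
Proof.
move=> mY t01; rewrite -{2}[t]/(fine t%:E) -(uniform01_cdf t01).
by apply: cdf_dist_le_d_KS => //; exact: measurable_id.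
Qed.

Lemma d_KS_U01_ge0 (R : realType) d (Omega : measurableType d)
    (P : probability Omega R) (Y : Omega -> R) :
  measurable_fun [set: Omega] Y -> 0 <= d_KS_U01 P Y.
Proof.
move=> mY; apply: (le_trans (normr_ge0 _)).
by apply: (@cdf_dist_le_d_KS_U01 _ _ _ P Y 0 mY); rewrite lexx ler01.
Qed.

(** * Counts and order statistics *)

Lemma measurable_sum_bool d (X : measurableType d) (n : nat)
    (b : 'I_n -> X -> bool) : (forall i, measurable_fun [set: X] (b i)) ->
  measurable_fun [set: X] (fun x => \sum_(i < n) b i x)%N.
Proof.
move=> mb; elim: n b mb => [|n IH] b mb.
  by under eq_fun do rewrite big_ord0; exact: measurable_cst.
under eq_fun do rewrite big_ord_recr/=.
apply: measurable_fun_addn; first exact: IH.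
exact: (measurableT_comp (f := nat_of_bool)).
Qed.

Lemma count_tnth (T : Type) (n : nat) (w : n.-tuple T) (p : pred T) :
  count p w = (\sum_(i < n) p (tnth w i))%N.
Proof.
by rewrite -sum1_count big_mkcond big_tuple; apply: eq_bigr => i _; case: (p _).
Qed.

(** The [a]-th order statistic sits at index [a - 1] of the sorted tuple, within range since
    [a <= B]. For [a = 0] both sides are true. *)
Lemma order_stat_le_count (R : realType) (B a : nat) (w : B.-tuple R) (x : R) :
  (a <= B)%N ->
  (order_stat w a <= x%:E)%E = (a <= \sum_(i < B) (tnth w i <= x)%R)%N.
Proof.
rewrite -(@count_tnth R _ w (fun y => y <= x)); case: a => [|a] aB /=.
  by rewrite leNye leq0n.
rewrite lee_fin -(permP (permEl (perm_sort <=%R w))).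
apply: (sorted_nth_count (p := fun y => y <= x)).
- by move=> u v uv vx; exact: le_trans vx.
- by apply: sort_sorted; exact: le_total.
- by rewrite size_sort size_tuple.
Qed.

(** By negation: the [c]-th order statistic is below [x] exactly when at least [c] entries are
    strictly below [x]. *)
Lemma le_order_stat_count (R : realType) (B c : nat) (w : B.-tuple R) (x : R) :
  (0 < c <= B)%N ->
  (x%:E <= order_stat w c)%E = (\sum_(i < B) (tnth w i < x)%R < c)%N.
Proof.
rewrite -(@count_tnth R _ w (fun y => y < x)); case: c => [//|c] /= cB.
rewrite lee_fin -(permP (permEl (perm_sort <=%R w))) ltnS leNgt leqNgt.
congr (~~ _); apply: (sorted_nth_count (p := fun y => y < x)).
- by move=> u v uv vx; exact: le_lt_trans vx.
- by apply: sort_sorted; exact: le_total.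
- by rewrite size_sort size_tuple.
Qed.

(** * Lower tails of conditional counts *)

(* [kappa z] carries only a measure structure; this copy is canonically a
   probability. *)
Definition kernel_law d d' (R : realType) (T : measurableType d)
    (U : measurableType d') (kappa : R.-pker T ~> U) (z : T) : set U -> \bar R :=
  kappa z.

Section kernel_law_probability.
Context d d' (R : realType) (T : measurableType d) (U : measurableType d').
Variables (kappa : R.-pker T ~> U) (z : T).

HB.instance Definition _ := Measure.copy (kernel_law kappa z) (kappa z).

HB.instance Definition _ :=
  Measure_isProbability.Build _ _ R (kernel_law kappa z) (prob_kernel z).

End kernel_law_probability.

(** The event depends on [z] as well; it is the section at [z] of a measurable set of the product,
    and kernels are measurable along sections. *)
Lemma measurable_kernel_marginal (R : realType) (d' : measure_display)
    (T : measurableType d') (B : nat) (kappa : R.-pker T ~> (B.-tuple R))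
    (c : T -> pred R) (i : 'I_B) :
  measurable_fun [set: T * R] (fun x => c x.1 x.2) ->
  measurable_fun [set: T] (fun z => fine (kappa z [set w | c z (tnth w i)])).
Proof.
move=> mc; apply: measurableT_comp => //.
pose E := [set x : T * B.-tuple R | c x.1 (tnth x.2 i)].
have mE : measurable E.
  have mci : measurable_fun [set: T * B.-tuple R] (fun x => c x.1 (tnth x.2 i)).
    apply: (measurableT_comp mc (g := fun x => (x.1, tnth x.2 i))).
    apply: measurable_fun_pair => //.
    exact: (measurableT_comp (measurable_tnth i)).
  by rewrite -[E]setTI; exact: (mci measurableT [set true]).
rewrite (_ : (fun z => _) = (fun z => kappa z (xsection E z))).
  by apply: measurable_fun_xsection_finite_kernel; rewrite inE.
by apply/funext => z; rewrite xsectionE.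
Qed.

(** The predicate [c] is left general so as to serve both ends of the interval. The tail bound
    depends on [z] only through the conditional mean count, whose law is controlled by the
    hypothesis on the distribution function. *)
Lemma conditional_count_lower_tail (R : realType) (d d' : measure_display)
    (Omega : measurableType d) (T : measurableType d')
    (P : probability Omega R) (B : nat) (W : 'I_B -> {RV P >-> R})
    (Z : {RV P >-> T}) (kappa : R.-pker T ~> (B.-tuple R))
    (c : T -> pred R) (k : nat) (delta : R) :
  (0 < B)%N -> regular_cond_distribution W Z kappa ->
  (forall z, product_of_marginals (kappa z)) ->
  measurable_fun [set: T * R] (fun x => c x.1 x.2) -> 0 <= delta ->
  (forall t, 0 <= t <= 1 ->
    (P [set om | (B%:R^-1 * \sum_(i < B)
       fine (kappa (Z om) [set w | c (Z om) (tnth w i)]) <= t)%R]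
     <= (t + delta)%:E)%E) ->
  (P [set om | (\sum_(i < B) c (Z om) (W i om) <= k)%N]
   <= (3 * k.+1%:R / (2 * B%:R) + delta)%:E)%E.
Proof.
move=> B0 PWZ indep mc delta0 cdf.
have B0' : 0 < B%:R :> R by rewrite ltr0n.
pose p z i := fine (kappa z [set w | c z (tnth w i)]).
pose Y z := B%:R^-1 * \sum_(i < B) p z i.
pose E := [set x : T * B.-tuple R | (\sum_(i < B) c x.1 (tnth x.2 i) <= k)%N].
have mE : measurable E.
  have mN : measurable_fun [set: T * B.-tuple R]
      (fun x => \sum_(i < B) c x.1 (tnth x.2 i))%N.
    apply: measurable_sum_bool => i.
    apply: (measurableT_comp mc (g := fun x => (x.1, tnth x.2 i))).
    apply: measurable_fun_pair => //.
    exact: (measurableT_comp (measurable_tnth i)).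
  by rewrite -[E]setTI; exact: (mN measurableT [set m | (m <= k)%N]).
have mcz z : measurable_fun [set: R] (c z).
  by apply: (measurableT_comp mc (g := pair z)); exact: pair1_measurable.
have mcw z i : measurable [set w : B.-tuple R | c z (tnth w i)].
  have mczi : measurable_fun [set: B.-tuple R] (fun w => c z (tnth w i)).
    exact: (measurableT_comp (mcz z) (measurable_tnth i)).
  by rewrite -[X in measurable X]setTI; exact: (mczi measurableT [set true]).
have mY : measurable_fun [set: T] Y.
  apply: measurable_funM => //; apply: measurable_sum => i.
  exact: measurable_kernel_marginal.
have Y01 z : 0 <= Y z <= 1.
  have p01 i : 0 <= p z i <= 1.
    apply/andP; split; first exact: fine_ge0.
    rewrite -lee_fin fineK ?(fin_num_measure (kernel_law kappa z))//.
    exact: (probability_le1 (kernel_law kappa z)).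
  rewrite /Y mulr_ge0 ?invr_ge0 ?sumr_ge0//=; last first.
    by move=> i _; have /andP[] := p01 i.
  rewrite ler_pdivrMl// mulr1.
  have -> : B%:R = \sum_(i < B) (1 : R) by rewrite sumr_const card_ord.
  by apply: ler_sum => i _; have /andP[] := p01 i.
have -> : [set om | (\sum_(i < B) c (Z om) (W i om) <= k)%N] =
    [set om | E (Z om, [tuple W i om | i < B])].
  apply/funext => om; rewrite /E/=; congr (is_true (_ <= _)%N).
  by apply: eq_bigr => i _; rewrite tnth_mktuple.
rewrite (disintegration PWZ mE).
(* The mean count is [B * Y z]; rescaling the variable by [B] divides the primitive by [B]. *)
pose g x := lower_tail_bound k (B%:R * x) : R.
pose G x := lower_tail_primitive k (B%:R * x) / B%:R : R.
apply: (@le_trans _ _ (G 1 - G 0 + delta)%:E).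
  apply: (@expectation_nonincreasing_le _ _ _ (distribution P Z) Y _ g) => //.
  - by apply: measurable_fun_xsection_finite_kernel; rewrite inE.
  - move=> z; rewrite measure_ge0/=.
    have := @independent_count_lower_tail R B k (kernel_law kappa z) (fun=> c z) (indep z).
    rewrite /g /Y mulVKf ?gt_eqF// xsectionE; apply => i.
    by rewrite -[X in measurable X]setTI; exact: (mcz z measurableT [set true]).
  - by move=> x; rewrite lower_tail_bound_ge0 lower_tail_bound_le1.
  - by move=> x y xy; apply: lower_tail_bound_nonincreasing; rewrite ler_pM2l.
  - move=> x y xy; rewrite /G /g -mulrBl ler_pdivlMr//.
    rewrite -mulrA mulrBl ![_ * B%:R]mulrC.
    by apply: lower_tail_primitive_step; rewrite ler_pM2l.
rewrite lee_fin lerD2r /G mulr0 {2}/lower_tail_primitive ler0n mul0r subr0.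
rewrite mulr1 invfM mulrA ler_wpM2r ?invr_ge0//.
exact: lower_tail_primitive_le.
Qed.

(** Lets the count of entries above [psi z] be treated as a lower tail, with mean proportion
    [1 - mean_cond_cdf]. *)
Lemma mean_cond_cdf_compl (R : realType) (d' : measure_display)
    (T : measurableType d') (B : nat) (kappa : R.-pker T ~> (B.-tuple R))
    (psi : T -> R) (z : T) : (0 < B)%N ->
  B%:R^-1 * \sum_(i < B) fine (kappa z [set w | psi z < tnth w i]) =
  1 - mean_cond_cdf kappa psi z.
Proof.
move=> B0; rewrite /mean_cond_cdf.
have mw i : measurable [set w : B.-tuple R | tnth w i <= psi z].
  rewrite -[X in measurable X]setTI; apply: measurable_fun_le => //.
  exact: measurable_tnth.
have -> : \sum_(i < B) fine (kappa z [set w | psi z < tnth w i]) =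
    \sum_(i < B) (1 - cond_cdf kappa psi i z).
  apply: eq_bigr => i _; rewrite /cond_cdf.
  have -> : [set w : B.-tuple R | psi z < tnth w i] =
            ~` [set w | tnth w i <= psi z].
    by apply/funext => w /=; apply/propext; rewrite ltNge; split => /negP.
  change (fine (kernel_law kappa z (~` [set w | tnth w i <= psi z])) =
    1 - fine (kernel_law kappa z [set w | tnth w i <= psi z])).
  by rewrite probability_setC// fineB// fin_num_measure.
rewrite sumrB sumr_const card_ord mulrBr mulVf//.
by rewrite pnatr_eq0 -lt0n.
Qed.

Theorem theorem3 (R : realType) (d d' : measure_display)
    (Omega : measurableType d) (T : measurableType d')
    (P : probability Omega R)
    (B : nat) (hB : (1 <= B)%N)
    (W : 'I_B -> {RV P >-> R}) (Z : {RV P >-> T})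
    (kappa : R.-pker T ~> (B.-tuple R))
    (hkappa : regular_cond_distribution W Z kappa)
    (hindep : forall z : T, product_of_marginals (kappa z))
    (psi : T -> R) (hpsi : measurable_fun [set: T] psi)
    (a b : nat) (hab : (a < B - b <= B)%N) :
  ((1 - (3 * (a + b + 1)%:R) / (2 * B%:R)
      - 6 * d_KS_U01 P (fun om => mean_cond_cdf kappa psi (Z om)))%:E
   <= P [set om |
         (order_stat [tuple W i om | i < B] a <= (psi (Z om))%:E
            <= order_stat [tuple W i om | i < B] (B - b))%E])%E.

Proof.
set Y := fun om => mean_cond_cdf kappa psi (Z om); set delta := d_KS_U01 P Y.
have B0 : 0 < B%:R :> R by rewrite ltr0n.
have mle : measurable_fun [set: T * R] (fun x => x.2 <= psi x.1).
  by apply: measurable_fun_ler => //; exact: measurableT_comp.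
have mgt : measurable_fun [set: T * R] (fun x => psi x.1 < x.2).
  by apply: measurable_fun_ltr => //; exact: measurableT_comp.
have mY : measurable_fun [set: Omega] Y.
  apply: (measurableT_comp (f := mean_cond_cdf kappa psi)) => //.
  apply: measurable_funM => //; apply: measurable_sum => i.
  exact: (@measurable_kernel_marginal _ _ _ _ kappa (fun z x => x <= psi z)).
have delta0 : 0 <= delta by exact: d_KS_U01_ge0.
have mYle t : measurable [set om | Y om <= t].
  by rewrite -[X in measurable X]setTI; exact: measurable_fun_le.
have PY t : P [set om | Y om <= t] = (fine (P [set om | Y om <= t]))%:E.
  by rewrite fineK// fin_num_measure.
have cdfY t : 0 <= t <= 1 -> `|fine (P [set om | Y om <= t]) - t| <= delta.
  exact: cdf_dist_le_d_KS_U01.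
have lower k : (P [set om | (\sum_(i < B) (W i om <= psi (Z om))%R <= k)%N]
    <= (3 * k.+1%:R / (2 * B%:R) + delta)%:E)%E.
  apply: (@conditional_count_lower_tail _ _ _ _ _ _ _ W Z kappa
    (fun z x => x <= psi z)) => // t t01.
  rewrite (PY t) lee_fin.
  have := cdfY t t01; rewrite ler_norml => /andP[_].
  by rewrite lerBlDr addrC.
have upper k : (P [set om | (\sum_(i < B) (psi (Z om) < W i om)%R <= k)%N]
    <= (3 * k.+1%:R / (2 * B%:R) + delta)%:E)%E.
  apply: (@conditional_count_lower_tail _ _ _ _ _ _ _ W Z kappa
    (fun z x => psi z < x)) => // t t01.
  rewrite (_ : [set om | _] = [set om | 1 - Y om <= t]); last first.
    by apply/funext => om /=; rewrite mean_cond_cdf_compl.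
  (* The event is [1 - t <= Y], whose complement is a strict inequality, while [cdfY] concerns
     [Y <= u]; hence the slack [e]. *)
  apply/lee_addgt0Pr => e e0; rewrite -EFinD.
  apply: (@le_trans _ _ (P (~` [set om | Y om <= 1 - t - e]))).
    apply: le_measure; rewrite ?inE.
    - rewrite -[X in measurable X]setTI; apply: measurable_fun_le => //.
      exact: measurable_funB.
    - exact: measurableC.
    - by move=> om /= Yt; apply/negP; rewrite -ltNge; lra.
  rewrite probability_setC// PY -EFinB lee_fin.
  (* Below 0 [cdfY] does not apply, but then [t + e] exceeds 1 and the bound is trivial. *)
  have [te|te] := leP 0 (1 - t - e).
    have /andP[t0 t1] := t01.
    have := cdfY (1 - t - e); rewrite ler_norml te/= => /(_ _)/andP[]; first by lra.
    by lra.
  have : 0 <= fine (P [set om | Y om <= 1 - t - e]) by rewrite fine_ge0.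
  by lra.
pose N om := (\sum_(i < B) (W i om <= psi (Z om))%R)%N.
pose M om := (\sum_(i < B) (W i om < psi (Z om))%R)%N.
pose U om := (\sum_(i < B) (psi (Z om) < W i om)%R)%N.
have mN : measurable_fun [set: Omega] N.
  apply: measurable_sum_bool => i; apply: measurable_fun_ler => //.
  exact: measurableT_comp.
have mM : measurable_fun [set: Omega] M.
  apply: measurable_sum_bool => i; apply: measurable_fun_ltr => //.
  exact: measurableT_comp.
have mU : measurable_fun [set: Omega] U.
  apply: measurable_sum_bool => i; apply: measurable_fun_ltr => //.
  exact: measurableT_comp.
(* Ties [W i om = psi (Z om)] are counted in neither [U] nor [M], hence only an inequality. *)
have UM om : (U om + M om <= B)%N.
  rewrite /U /M -big_split/= -[leqRHS]card_ord -sum1_card.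
  by apply: leq_sum => i _; case: ltgtP.
have mNset A : measurable (N @^-1` A).
  by rewrite -[X in measurable X]setTI; exact: mN.
have mMset A : measurable (M @^-1` A).
  by rewrite -[X in measurable X]setTI; exact: mM.
have mUset A : measurable (U @^-1` A).
  by rewrite -[X in measurable X]setTI; exact: mU.
(* The lower end fails when [N < a], the upper end when [B - b <= M]. *)
rewrite [X in (_ <= P X)%E](_ : _ =
    ~` (N @^-1` [set n | (n < a)%N] `|` M @^-1` [set n | (B - b <= n)%N])); last first.
  apply/funext => om /=; rewrite order_stat_le_count; last by lia.
  rewrite le_order_stat_count; last by lia.
  under eq_bigr do rewrite tnth_mktuple.
  under [X in (_ && (X < _)%N)]eq_bigr do rewrite tnth_mktuple.
  rewrite -/(N om) -/(M om); apply/propext; split=> [/andP[aN MB] []|NM].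
  - by lia.
  - by lia.
  - by apply/andP; split; rewrite ltnNge || rewrite leqNgt; apply/negP => ?;
      apply: NM; [left|right].
rewrite probability_setC; last exact: measurableU.
have Na : (P (N @^-1` [set n | (n < a)%N]) <=
    (3 * a%:R / (2 * B%:R) + delta)%:E)%E.
  (* For [a = k.+1], [N < a] is [N <= k], so the bound has [a] and not [a + 1]; for [a = 0] the
     event is empty. *)
  case: (a) => [|k]; last exact: lower.
  rewrite (_ : _ @^-1` _ = set0) ?measure0 ?mulr0 ?mul0r ?add0r ?lee_fin//.
  by apply/seteqP; split.
have Mb : (P (M @^-1` [set n | (B - b <= n)%N]) <=
    (3 * b.+1%:R / (2 * B%:R) + delta)%:E)%E.
  apply: le_trans (upper b); apply: le_measure; rewrite ?inE.
  - exact: mMset.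
  - exact: (mUset [set n | (n <= b)%N]).
  - by move=> om /=; have := UM om; rewrite -/(U om); lia.
have NM := le_trans (measureU2 P (mNset _) (mMset _)) (leeD Na Mb).
apply: le_trans (leeB (lexx 1%:E) NM).
rewrite -EFinD lee_fin -[b.+1]addn1 [(a + b + 1)%N]addnAC !natrD.
have -> : 1 - (3 * a%:R / (2 * B%:R) + delta + (3 * (b%:R + 1) / (2 * B%:R) + delta)) =
  1 - 3 * (a%:R + 1 + b%:R) / (2 * B%:R) - 2 * delta :> R.
  by field; rewrite gt_eqF.
(* Each tail costs one [delta], and [2 * delta <= 6 * delta]. *)
by rewrite lerD2l lerN2 ler_wpM2r// ler_nat.
Qed.
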